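(* A Boolean relation $R\subseteq\{0,1\}^2$ of arity $2$ is balanced if and only if it is not cone-interdefinable with the $2$-OR relation.
   Context: A partial Boolean operation $f$ of arity $\ell$ is balanced if there are integers $\alpha_1,\ldots,\alpha_\ell$ with $\sum\alpha_i=1$ such that its domain is exactly the tuples with $\sum\alpha_ix_i\in\{0,1\}$, on which $f(x)=\sum\alpha_ix_i$. $f$ preserves $T\subseteq\{0,1\}^m$ if for all $t^1,\ldots,t^\ell\in T$, whenever the coordinatewise application of $f$ is defined in every coordinate, the result lies in $T$; a relation is balanced if preserved by all balanced operations. The $2$-OR relation is $\{(0,1),(1,0),(1,1)\}$. A relation $T$ of arity $m$ is cone-definable from a relation $U$ of arity $n$ if there is a tuple $(y_1,\ldots,y_n)$ with each $y_j\in\{0,1\}\cup\{x_1,\ldots,x_m\}\cup\{\neg x_1,\ldots,\neg x_m\}$, every $x_i$ occurs (as $x_i$ or $\neg x_i$) among the $y_j$, and for each $f\colon\{x_1,\ldots,x_m\}\to\{0,1\}$: $(f(x_1),\ldots,f(x_m))\in T$ iff $(\hat f(y_1),\ldots,\hat f(y_n))\in U$, where $\hat f(0)=0$, $\hat f(1)=1$, $\hat f(x_i)=f(x_i)$, $\hat f(\neg x_i)=\neg f(x_i)$. Two relations are cone-interdefinable if each is cone-definable from the other. *)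

(* Defs.v *)
From mathcomp Require Import all_boot all_order all_algebra.

Set Implicit Arguments.
Unset Strict Implicit.
Unset Printing Implicit Defensive.

Import GRing.Theory.
Local Open Scope ring_scope.

Definition boolrel (m : nat) := {set m.-tuple bool}.

(* [None] means that the operation is undefined on the given tuple. *)
Definition partial_op (l : nat) := l.-tuple bool -> option bool.

Definition weighted_sum (l : nat) (alpha : 'I_l -> int) (x : l.-tuple bool) : int :=
  \sum_(i < l) alpha i * (tnth x i)%:Z.

Definition balanced_op (l : nat) (f : partial_op l) : Prop :=
  exists alpha : 'I_l -> int,
    [/\ \sum_(i < l) alpha i = 1,
        forall x, isSome (f x) <-> (weighted_sum alpha x = 0 \/ weighted_sum alpha x = 1)
      & forall x b, f x = Some b -> b%:Z = weighted_sum alpha x].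

Definition preserves (l m : nat) (f : partial_op l) (T : boolrel m) : Prop :=
  forall t : 'I_l -> m.-tuple bool, (forall i, t i \in T) ->
  forall u : m.-tuple bool,
    (forall j : 'I_m, f [tuple tnth (t i) j | i < l] = Some (tnth u j)) -> u \in T.

Definition balanced (m : nat) (T : boolrel m) : Prop :=
  forall (l : nat) (f : partial_op l), balanced_op f -> preserves f T.

Definition or2 : boolrel 2 :=
  [set [tuple false; true]; [tuple true; false]; [tuple true; true]].

Inductive cone_term (m : nat) : Type :=
  | Const of bool
  | Var of 'I_m
  | NegVar of 'I_m.

Arguments Const {m} _.

Definition cone_eval (m : nat) (f : m.-tuple bool) (y : cone_term m) : bool :=
  match y with
  | Const b => b
  | Var i => tnth f i
  | NegVar i => ~~ tnth f i
  end.

(* [cone_definable T U]: T is cone-definable from U. *)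
Definition cone_definable (m n : nat) (T : boolrel m) (U : boolrel n) : Prop :=
  exists y : n.-tuple (cone_term m),
    (forall i : 'I_m, exists j : 'I_n, tnth y j = Var i \/ tnth y j = NegVar i) /\
    (forall f : m.-tuple bool,
       f \in T <-> [tuple cone_eval f (tnth y j) | j < n] \in U).

Definition cone_interdefinable (m n : nat) (T : boolrel m) (U : boolrel n) : Prop :=
  cone_definable T U /\ cone_definable U T.

(* Main.v *)
Require Import Defs.
From mathcomp Require Import all_boot all_order all_algebra.

(** A relation of arity 2 is cone-interdefinable with 2-OR exactly when it omits
    a single pair: complementing coordinates moves the omitted pair anywhere.
    Cone-definitions transfer balancedness, because a balanced operation
    commutes with constants (the weights sum to 1) and with negation, and 2-OR
    is not balanced, since (0,0) = (0,1) - (1,1) + (1,0).  Conversely, if the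
    binary relation R omits besides u another pair v, an integer affine
    equation holds on R and fails at u; balanced operations preserve such
    equations, so they cannot produce u from R. *)

Set Implicit Arguments.
Unset Strict Implicit.
Unset Printing Implicit Defensive.

Import GRing.Theory.
Local Open Scope ring_scope.

Lemma weighted_sum_mktuple (l : nat) (alpha : 'I_l -> int) (g : 'I_l -> bool) :
  weighted_sum alpha [tuple g i | i < l] = \sum_(i < l) alpha i * (g i)%:Z.
Proof. by apply: eq_bigr => i _; rewrite tnth_mktuple. Qed.

(** The integer [b%:Z] determines [b], so the domain and value conditions merge into one equivalence
    describing the graph of [f]. *)
Lemma balanced_opP (l : nat) (f : partial_op l) :
  balanced_op f ->
  exists2 alpha : 'I_l -> int, \sum_(i < l) alpha i = 1 &
    forall x b, f x = Some b <-> weighted_sum alpha x = b%:Z.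
Proof.
case=> alpha [sum1 dom val]; exists alpha => // x b; split=> [/val // | wE].
have: isSome (f x) by apply/dom; rewrite wE; case: b {wE}; [right | left].
case E: (f x) => [c|] // _; congr Some.
by move/val: E; rewrite wE; case: b c {wE} => [] [].
Qed.

Lemma cone_definable_balanced (m n : nat) (T : boolrel m) (U : boolrel n) :
  cone_definable T U -> balanced U -> balanced T.
Proof.
case=> y [_ yP] balU l f fbal t tT u fu; apply/yP.
apply: (balU l f fbal
  (fun i => [tuple cone_eval (t i) (tnth y j) | j < n])) => [i|j]; first exact/yP.
have [alpha sum1 fE] := balanced_opP fbal.
have wu k : \sum_(i < l) alpha i * (tnth (t i) k)%:Z = (tnth u k)%:Z.
  by rewrite -weighted_sum_mktuple; apply/fE.
apply/fE; rewrite weighted_sum_mktuple tnth_mktuple.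
under eq_bigr do rewrite tnth_mktuple.
case: (tnth y j) => [b|k|k] /=; first by rewrite -mulr_suml sum1 mul1r.
  exact: wu.
(* Negation is affine over the integers, so weights of sum 1 respect it. *)
have negZ (b : bool) : (~~ b)%:Z = 1 - b%:Z by case: b.
under eq_bigr do rewrite negZ mulrBr mulr1.
by rewrite sumrB sum1 wu negZ.
Qed.

(** Exchanging the two sums turns the value at [u] into the [alpha]-combination of the values at the
    [t i], all equal to [c]. *)
Lemma balanced_op_affine (l m : nat) (f : partial_op l) (a : 'I_m -> int) (c : int)
    (t : 'I_l -> m.-tuple bool) (u : m.-tuple bool) :
    balanced_op f ->
    (forall i, weighted_sum a (t i) = c) ->
    (forall j, f [tuple tnth (t i) j | i < l] = Some (tnth u j)) ->
  weighted_sum a u = c.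
Proof.
move=> /balanced_opP[alpha sum1 fE] tc fu; rewrite /weighted_sum.
under eq_bigr => j _.
  rewrite -((fE _ _).1 (fu j)) weighted_sum_mktuple mulr_sumr.
  under eq_bigr do rewrite mulrCA.
  over.
rewrite exchange_big /=.
under eq_bigr => i _ do rewrite -mulr_sumr [X in _ * X]tc.
by rewrite -mulr_suml sum1 mul1r.
Qed.

Lemma balanced_affine_separated (m : nat) (R : boolrel m) :
    (forall u, u \notin R -> exists (a : 'I_m -> int) (c : int),
      (forall t, t \in R -> weighted_sum a t = c) /\ weighted_sum a u <> c) ->
  balanced R.
Proof.
move=> sep l f fbal t tR u fu; apply/negPn/negP => /sep[a [c [Rc]]]; apply.
by apply: (balanced_op_affine fbal) fu => i; apply/Rc.
Qed.

(** Negating exactly the coordinates where [v] and [w] differ is a bijection taking [v] to [w]. *)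
Lemma cone_definable_setC1 (m : nat) (v w : m.-tuple bool) :
  cone_definable (~: [set v]) (~: [set w]).
Proof.
exists [tuple if tnth v j == tnth w j then Var j else NegVar j | j < m].
split=> [i | x].
  by exists i; rewrite tnth_mktuple; case: ifP; [left | right].
rewrite !inE; set y := mktuple _; suff -> : (x == v) = (y == w) by [].
rewrite !eqEtuple; apply: eq_forallb => j; rewrite !tnth_mktuple.
by case: (tnth v j) (tnth w j) => [] [] /=; case: (tnth x j).
Qed.

Lemma tuple2E (T : Type) (x : 2.-tuple T) :
  x = [tuple tnth x ord0; tnth x ord_max].
Proof.
apply: eq_from_tnth => -[[|[|//]] ltj]; rewrite [RHS](tnth_nth (tnth x ord0)) /=;
  by congr tnth; apply: val_inj.
Qed.

Lemma or2E : or2 = ~: [set [tuple false; false]].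
Proof.
apply/setP=> x; rewrite !inE (tuple2E x).
by case: (tnth x ord0); case: (tnth x ord_max).
Qed.

Lemma or2_not_balanced : ~ balanced or2.
Proof.
pose alpha (i : 'I_3) : int := if i == 1 then -1 else 1.
pose f (x : 3.-tuple bool) :=
  if weighted_sum alpha x == 0 then Some false
  else if weighted_sum alpha x == 1 then Some true else None.
have fbal : balanced_op f.
  exists alpha; rewrite /f; split=> [|x|x b].
  - by rewrite !big_ord_recl big_ord0.
  - case: eqP => [->|w0]; first by split=> // _; left.
    case: eqP => [->|w1]; first by split=> // _; right.
    by split=> // -[].
  - by case: eqP => [->|_]; [|case: eqP => [->|_]] => // -[<-].
(* The pairs (0,1), (1,1), (1,0), in the order of the weights 1, -1, 1. *)
pose t (i : 'I_3) : 2.-tuple bool := [tuple i != 0; i != 2%:R].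
have tor i : t i \in or2 by rewrite or2E !inE; case: i => [[|[|[|]]]].
move=> or2bal.
suff: [tuple false; false] \in or2 by rewrite or2E !inE eqxx.
apply: (or2bal _ f fbal t tor) => j; rewrite /f weighted_sum_mktuple !big_ord_recl big_ord0.
by case: j => [[|[|]]].
Qed.

(* After complementing the coordinates where [u] is 1, so that [u] becomes
   (0,0) and [v] becomes d, the points other than 0 and d are those with
   d_1 y_0 + d_0 y_1 = 1. *)
Lemma binary_affine_separated (R : boolrel 2) (u v : 2.-tuple bool) :
    u \notin R -> v \notin R -> u != v ->
  exists (a : 'I_2 -> int) (c : int),
    (forall t, t \in R -> weighted_sum a t = c) /\ weighted_sum a u <> c.
Proof.
move=> uR vR uv.
pose a (j : 'I_2) : int :=
  (tnth u (rev_ord j) != tnth v (rev_ord j))%:Z * (-1) ^+ tnth u j.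
(* Since y_j = (-1)^(u_j) (t_j - u_j), the sum at [t] exceeds the one at [u] by d_1 y_0 + d_0
   y_1. *)
exists a, (weighted_sum a u + 1); split=> [t tR|]; last first.
  by move/eqP; rewrite -subr_eq0 opprD addNKr.
have tu : t != u by apply: contraNneq uR => <-.
have tv : t != v by apply: contraNneq vR => <-.
move: uv tu tv; rewrite /weighted_sum /a.
rewrite (tuple2E u) (tuple2E v) (tuple2E t) !big_ord_recl !big_ord0.
by case: (tnth u ord0) (tnth u ord_max) (tnth v ord0) (tnth v ord_max)
         (tnth t ord0) (tnth t ord_max) => [] [] [] [] [] [].
Qed.

Theorem theorem6p2 (R : boolrel 2) :
  balanced R <-> ~ cone_interdefinable R or2.
Proof.
split=> [balR [_ orR] | notor].
  exact: or2_not_balanced (cone_definable_balanced orR balR).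
apply: balanced_affine_separated => u uR.
(* Without a second omitted pair, [R] is the complement of [u], contradicting [notor]. *)
case: (pickP [pred v | (v \notin R) && (u != v)]) => [v /andP[vR uv] | only].
  exact: binary_affine_separated vR uv.
case: notor; have -> : R = ~: [set u].
  apply/setP=> v; rewrite !inE; have [-> | vu] := eqVneq v u; first exact: negbTE.
  by move: (only v); rewrite /= eq_sym vu andbT => /negbFE.
by rewrite or2E; split; apply: cone_definable_setC1.
Qed.
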